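(* Consider the regularised optimal transport problem $$\min_{T\in\mathcal T} L(T)\quad\text{subject to}\quad \sum_{(i,j)\in\mathcal Z}a^l_{ij}t_{ij}=\tilde b^l,\quad l=N_1+1,\dots,N, \qquad (\ast)$$ with the data described in the context. Suppose $(\ast)$ is feasible (i.e. some $T\in\mathcal T$ satisfies its equality constraints). Let $\{(T(k),b(k))\}_{k\ge 0}$, with $T(k)\in\mathcal T$ and $b(k)\in\mathbb R^{N_1}$, be the sequence generated by the following algorithm. Initialize $t_{ij}(0)=k_{ij}$ for $(i,j)\in\mathcal Z$, and $b^l(0)=\tilde b^l$ for $l=1,\dots,N_1$. For $k=0,1,2,\dots$ let $l=(k \bmod N)+1$. (i) If $1\le l\le N_1$, set $t_{ij}(k+1)=c_l(k+1)^{a^l_{ij}}t_{ij}(k)$ for $(i,j)\in\mathcal Z$, $b^l(k+1)=c_l(k+1)^{-1/\gamma_l}b^l(k)$, and $b^{s}(k+1)=b^{s}(k)$ for $s\ne l$, where $c_l(k+1)>0$ satisfies $$\sum_{(i,j)\in\mathcal Z}a^l_{ij}\,t_{ij}(k)\,c_l(k+1)^{a^l_{ij}}-b^l(k)\,c_l(k+1)^{-1/\gamma_l}=0.$$ (ii) If $N_1+1\le l\le N$, set $t_{ij}(k+1)=c_l(k+1)^{a^l_{ij}}t_{ij}(k)$ for $(i,j)\in\mathcal Z$, and $b(k+1)=b(k)$, where $c_l(k+1)>0$ satisfies $$\sum_{(i,j)\in\mathcal Z}a^l_{ij}\,t_{ij}(k)\,c_l(k+1)^{a^l_{ij}}=\tilde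 b^l.$$ Then the sequence $\{(T(k),b(k))\}$ converges to a limit $(T^*,b^* )$, and $T^*$ is a minimizer for the optimization problem $(\ast)$.
   Context: Let $m,n\ge1$ and $\mathcal Z\subseteq\{1,\dots,m\}\times\{1,\dots,n\}$ be such that every $i$ has at least one $j$ with $(i,j)\in\mathcal Z$ and every $j$ has at least one $i$ with $(i,j)\in\mathcal Z$. The set of allowable plans is $$\mathcal T=\{T=(t_{ij})\in\mathbb R^{m\times n}: t_{ij}\ge0 \text{ if }(i,j)\in\mathcal Z,\ t_{ij}=0\text{ if }(i,j)\notin\mathcal Z\}.$$ For $t\ge0$ and $\tilde t>0$, define $kl(t|\tilde t)=t\log(t/\tilde t)-t+\tilde t$ if $t>0$, and $kl(0|\tilde t)=\tilde t$. Given costs $c_{ij}\in\mathbb R$, a constant $\gamma_0>0$ and reference values $\tilde t_{ij}>0$ for $(i,j)\in\mathcal Z$, put $k_{ij}=\tilde t_{ij}\exp(-c_{ij}/\gamma_0)>0$ for $(i,j)\in\mathcal Z$, $k_{ij}=0$ otherwise, and $K=(k_{ij})$. Let $KL(T|K)=\sum_{(i,j)\in\mathcal Z}kl(t_{ij}|k_{ij})$. Let $N\ge 1$, $0\le N_1\le N$, and let $a^l_{ij}\in\mathbb R$ ($(i,j)\in\mathcal Z$) and $\tilde b^l\in\mathbb R$ be given for $l=1,\dots,N$, with $a^l_{ij}\ge0$, $\tilde b^l>0$ and $\gamma_l>0$ for $l=1,\dots,N_1$. The objective is $$L(T)=KL(T|K)+\sum_{l=1}^{N_1}\gamma_l\,kl\Big(\sum_{(i,j)\in\mathcal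 Z}a^l_{ij}t_{ij}\,\Big|\,\tilde b^l\Big).$$ *)

(* Defs.v *)
From HB Require Import structures.
From mathcomp Require Import all_boot all_order all_algebra.
From mathcomp Require Import all_classical all_reals all_analysis.
Import Order.TTheory GRing.Theory Num.Theory.
Import numFieldNormedType.Exports.

Set Implicit Arguments.
Unset Strict Implicit.
Unset Printing Implicit Defensive.

Local Open Scope ring_scope.

(* All indices are zero-based: the l-th constraint, l = 1, ..., N, is
   represented by l - 1 : 'I_N, so iteration k treats index k %% N.
   The parameters gamma and the vectors b(k), which concern only the first N1
   constraints, are indexed by 'I_N1, which is embedded in 'I_N by
   widen_ord (hN1 : N1 <= N).  Matrices of data given only on Z are total
   here; their entries outside Z are never used. *)

Definition allowable (R : realType) (m n : nat) (Z : {set 'I_m * 'I_n})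
    (T : 'M[R]_(m, n)) : Prop :=
  (forall i j, (i, j) \in Z -> 0 <= T i j) /\
  (forall i j, (i, j) \notin Z -> T i j = 0).

(* Only used for t >= 0 and s > 0; the else branch is the case t = 0. *)
Definition kl (R : realType) (t s : R) : R :=
  if 0 < t then t * ln (t / s) - t + s else s.

Definition Kmx (R : realType) (m n : nat) (Z : {set 'I_m * 'I_n})
    (cost tref : 'M[R]_(m, n)) (gamma0 : R) : 'M[R]_(m, n) :=
  \matrix_(i, j)
    if (i, j) \in Z then tref i j * expR (- cost i j / gamma0) else 0.

Definition KL (R : realType) (m n : nat) (Z : {set 'I_m * 'I_n})
    (T K : 'M[R]_(m, n)) : R :=
  \sum_(p in Z) kl (T p.1 p.2) (K p.1 p.2).

Definition lin (R : realType) (m n : nat) (Z : {set 'I_m * 'I_n})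
    (A T : 'M[R]_(m, n)) : R :=
  \sum_(p in Z) A p.1 p.2 * T p.1 p.2.

Definition objective (R : realType) (m n N N1 : nat) (hN1 : (N1 <= N)%N)
    (Z : {set 'I_m * 'I_n}) (K : 'M[R]_(m, n)) (a : 'I_N -> 'M[R]_(m, n))
    (btilde : 'I_N -> R) (gamma : 'I_N1 -> R) (T : 'M[R]_(m, n)) : R :=
  KL Z T K +
  \sum_(l < N1) gamma l *
    kl (lin Z (a (widen_ord hN1 l)) T) (btilde (widen_ord hN1 l)).

Definition feasible (R : realType) (m n N : nat) (N1 : nat)
    (Z : {set 'I_m * 'I_n}) (a : 'I_N -> 'M[R]_(m, n)) (btilde : 'I_N -> R)
    (T : 'M[R]_(m, n)) : Prop :=
  allowable Z T /\
  forall l : 'I_N, (N1 <= l)%N -> lin Z (a l) T = btilde l.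

Definition is_minimizer (R : realType) (m n N N1 : nat) (hN1 : (N1 <= N)%N)
    (Z : {set 'I_m * 'I_n}) (K : 'M[R]_(m, n)) (a : 'I_N -> 'M[R]_(m, n))
    (btilde : 'I_N -> R) (gamma : 'I_N1 -> R) (T : 'M[R]_(m, n)) : Prop :=
  feasible N1 Z a btilde T /\
  forall S : 'M[R]_(m, n), feasible N1 Z a btilde S ->
    objective hN1 Z K a btilde gamma T <= objective hN1 Z K a btilde gamma S.

Definition scaled_lin (R : realType) (m n : nat) (Z : {set 'I_m * 'I_n})
    (A T : 'M[R]_(m, n)) (c : R) : R :=
  \sum_(p in Z) A p.1 p.2 * T p.1 p.2 * c `^ A p.1 p.2.

Definition scaling (R : realType) (m n : nat) (Z : {set 'I_m * 'I_n})
    (A T T' : 'M[R]_(m, n)) (c : R) : Prop :=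
  forall i j, (i, j) \in Z -> T' i j = c `^ A i j * T i j.

Definition penalty_step (R : realType) (m n N1 : nat) (Z : {set 'I_m * 'I_n})
    (A : 'M[R]_(m, n)) (gamma : 'I_N1 -> R) (l : 'I_N1)
    (T : 'M[R]_(m, n)) (b : 'rV[R]_N1)
    (T' : 'M[R]_(m, n)) (b' : 'rV[R]_N1) : Prop :=
  exists c : R,
    [/\ 0 < c,
        scaled_lin Z A T c - b ord0 l * c `^ (- (gamma l)^-1) = 0,
        scaling Z A T T' c,
        b' ord0 l = c `^ (- (gamma l)^-1) * b ord0 l
      & forall s : 'I_N1, s != l -> b' ord0 s = b ord0 s].

Definition equality_step (R : realType) (m n N1 : nat) (Z : {set 'I_m * 'I_n})
    (A : 'M[R]_(m, n)) (beta : R)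
    (T : 'M[R]_(m, n)) (b : 'rV[R]_N1)
    (T' : 'M[R]_(m, n)) (b' : 'rV[R]_N1) : Prop :=
  exists c : R,
    [/\ 0 < c, scaled_lin Z A T c = beta, scaling Z A T T' c & b' = b].

(* Existence of the scaling factors c is part of being a run of the algorithm;
   a run is any sequence each of whose steps uses some admissible c > 0. *)
Definition generated (R : realType) (m n N N1 : nat) (hN1 : (N1 <= N)%N)
    (Z : {set 'I_m * 'I_n}) (K : 'M[R]_(m, n)) (a : 'I_N -> 'M[R]_(m, n))
    (btilde : 'I_N -> R) (gamma : 'I_N1 -> R)
    (T : nat -> 'M[R]_(m, n)) (b : nat -> 'rV[R]_N1) : Prop :=
  [/\ forall k, allowable Z (T k),
      forall i j, (i, j) \in Z -> T 0%N i j = K i j,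
      forall l : 'I_N1, b 0%N ord0 l = btilde (widen_ord hN1 l),
      forall (k : nat) (l : 'I_N1), (l : nat) = (k %% N)%N ->
        penalty_step Z (a (widen_ord hN1 l)) gamma l
          (T k) (b k) (T k.+1) (b k.+1)
    & forall (k : nat) (l : 'I_N), (N1 <= l)%N -> (l : nat) = (k %% N)%N ->
        equality_step Z (a l) (btilde l) (T k) (b k) (T k.+1) (b k.+1)].

(* Main.v *)
Require Import Defs.
From HB Require Import structures.
From mathcomp Require Import all_boot all_order all_algebra.
From mathcomp Require Import all_classical all_reals all_analysis.
From mathcomp Require Import ring lra.
Import Order.TTheory GRing.Theory Num.Theory.
Import numFieldNormedType.Exports.
Local Open Scope classical_set_scope.
Local Open Scope ring_scope.

(** The penalised values b l = sum a^l_ij t_ij are treated as additional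
variables.  With weight 1 on the entries of the plan and gamma l on b l, the
objective becomes the weighted Kullback-Leibler divergence
D((T, b), (K, btilde)), where D(y, x) = sum_i w_i kl(y_i | x_i) ([objectiveE]),
and all constraints, penalised or not, become linear equations
<r_l, (T, b)> = beta_l.  Each step of the algorithm then is the projection in
the sense of D onto one of these hyperplanes ([penalty_kl_step],
[equality_kl_step]), so the theorem is an instance of the convergence of cyclic
Bregman projections ([kl_cyclic_projections]).

That convergence rests on a Pythagorean identity: if x' is the projection of x
onto a hyperplane containing y, then D(y, x) = D(y, x') + D(x', x)
([kl_step_pythagoras]).  Here y only has to be nonnegative, while the iterates
stay positive; this covers feasible sets without positive points.  The
identity shows that D(y, x(k)) decreases for feasible y, and, by the bound
(sqrt t - sqrt s)^2 <= kl(t | s) ([kl_ge_sqrt]), that the iterates are bounded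
and that their successive differences tend to 0.  Hence a limit point p is
feasible, D(p, x(k)) tends to 0, and x(k) tends to p.  Optimality needs no dual
argument: the amount D(x', x) lost in a step does not depend on the feasible
point, so D(y, x(0)) - D(p, x(0)) = D(y, x(k)) - D(p, x(k)) >= - D(p, x(k)),
and the right-hand side tends to 0. *)

Set Implicit Arguments.
Unset Strict Implicit.
Unset Printing Implicit Defensive.

(** * The scalar divergence *)

Lemma kl0t (R : realType) (s : R) : kl 0 s = s.
Proof. by rewrite /kl ltxx. Qed.

Lemma klxx (R : realType) (s : R) : 0 <= s -> kl s s = 0.
Proof.
rewrite le_eqVlt => /predU1P[<-|s0]; first by rewrite kl0t.
by rewrite /kl s0 divff ?gt_eqF// ln1 mulr0 sub0r addNr.
Qed.

(** The bound ln u <= u - 1 at u = sqrt (s / t).  It is what turns a small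
divergence into closeness of the two points, with a constant that does not
degenerate as [t] or [s] tends to 0; this matters because the limit of the
iterates may have zero coordinates. *)
Lemma kl_ge_sqrt (R : realType) (t s : R) : 0 <= t -> 0 < s ->
  (Num.sqrt t - Num.sqrt s) ^+ 2 <= kl t s.
Proof.
rewrite le_eqVlt => /predU1P[<- s0|t0 s0].
  by rewrite kl0t sqrtr0 sub0r sqrrN sqr_sqrtr// ltW.
rewrite /kl t0; set u := Num.sqrt t; set v := Num.sqrt s.
have u0 : 0 < u by rewrite sqrtr_gt0.
have v0 : 0 < v by rewrite sqrtr_gt0.
have -> : t = u ^+ 2 by rewrite sqr_sqrtr// ltW.
have -> : s = v ^+ 2 by rewrite sqr_sqrtr// ltW.
have -> : ln (u ^+ 2 / v ^+ 2) = - (2 * ln (v / u)).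
  rewrite -exprVn -exprMn lnXn ?divr_gt0// -invf_div lnV ?posrE ?divr_gt0//.
  by rewrite mulr_natl mulNrn.
have lnle : ln (v / u) <= v / u - 1.
  have := @le_ln1Dx R (v / u - 1); rewrite [1 + _]addrC subrK; apply.
  by rewrite ltrBrDr addNr divr_gt0.
have : u ^+ 2 * ln (v / u) <= u ^+ 2 * (v / u - 1).
  by rewrite ler_wpM2l// exprn_ge0// ltW.
have -> : u ^+ 2 * (v / u - 1) = u * v - u ^+ 2 by field; rewrite gt_eqF.
lra.
Qed.

Lemma kl_ge0 (R : realType) (t s : R) : 0 <= t -> 0 < s -> 0 <= kl t s.
Proof. by move=> t0 s0; apply: le_trans (kl_ge_sqrt t0 s0); exact: sqr_ge0. Qed.

Lemma kl_sub (R : realType) (t s s' : R) : 0 <= t -> 0 < s -> 0 < s' ->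
  kl t s - kl t s' = t * ln (s' / s) + (s - s').
Proof.
rewrite le_eqVlt => /predU1P[<-|t0] s0 s'0; first by rewrite !kl0t mul0r add0r.
by rewrite /kl t0 !ln_div ?posrE//; ring.
Qed.

(** Converse to [kl_ge_sqrt]: convergence to [t] makes the divergence vanish,
even when [t] is on the boundary. *)
Lemma kl_cvg0 (R : realType) (t : R) (s : nat -> R) : 0 <= t ->
  s @ \oo --> t -> (fun k => kl t (s k)) @ \oo --> 0.
Proof.
move=> t0 st; have [tE|t_neq0] := eqVneq t 0.
  rewrite tE in st *; rewrite (_ : (fun _ => _) = s) //.
  by apply/funext => k; rewrite kl0t.
have t_gt0 : 0 < t by rewrite lt_def t_neq0.
have kE : (fun k => kl t (s k)) = (fun k => t * ln (t * (s k)^-1) - t + s k).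
  by apply/funext => k; rewrite /kl t_gt0.
rewrite kE [X in _ --> X](_ : 0 = t * ln (t * t^-1) - t + t); last first.
  by rewrite divff// ln1 mulr0 sub0r addNr.
apply: cvgD => //; apply: cvgB; last exact: cvg_cst.
apply: cvgM; first exact: cvg_cst.
apply: continuous_cvg.
  by apply: continuous_ln; rewrite divff.
by apply: cvgM; [exact: cvg_cst | exact: cvgV].
Qed.

(** * The weighted divergence and its projections *)

Definition wkl (R : realType) (I : finType) (w y x : I -> R) : R :=
  \sum_i w i * kl (y i) (x i).

(** The projection of [x] in the divergence [wkl w] onto the hyperplane
<r, x'> = beta: stationarity of [wkl w x' x] on that hyperplane says that
[w i * ln (x' i / x i)] is proportional to [r i], and [ln c] is the
multiplier. *)
Definition kl_step (R : realType) (I : finType) (w r : I -> R) (beta : R)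
    (x x' : I -> R) : Prop :=
  exists c : R,
    [/\ 0 < c, forall i, x' i = c `^ (r i / w i) * x i
      & \sum_i r i * x' i = beta].

Lemma wklxx (R : realType) (I : finType) (w x : I -> R) :
  (forall i, 0 <= x i) -> wkl w x x = 0.
Proof. by move=> x0; apply: big1 => i _; rewrite klxx// mulr0. Qed.

Lemma wkl_ge_sqrt (R : realType) (I : finType) (w y x : I -> R) i :
  (forall i, 0 < w i) -> (forall i, 0 <= y i) -> (forall i, 0 < x i) ->
  (Num.sqrt (y i) - Num.sqrt (x i)) ^+ 2 <= (w i)^-1 * wkl w y x.
Proof.
move=> w0 y0 x0; rewrite ler_pdivlMl//.
apply: (@le_trans _ _ (w i * kl (y i) (x i))).
  by rewrite ler_pM2l// kl_ge_sqrt.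
rewrite /wkl (bigD1 i)//= lerDl; apply: sumr_ge0 => j _.
by rewrite mulr_ge0 ?kl_ge0// ltW.
Qed.

Lemma wkl_ge0 (R : realType) (I : finType) (w y x : I -> R) :
  (forall i, 0 < w i) -> (forall i, 0 <= y i) -> (forall i, 0 < x i) ->
  0 <= wkl w y x.
Proof.
by move=> w0 y0 x0; apply: sumr_ge0 => i _; rewrite mulr_ge0 ?kl_ge0// ltW.
Qed.

Lemma wkl_cvg0_sqrt (R : realType) (I : finType) (w : I -> R)
    (y x : nat -> I -> R) i :
  (forall i, 0 < w i) -> (forall k i, 0 <= y k i) -> (forall k i, 0 < x k i) ->
  (fun k => wkl w (y k) (x k)) @ \oo --> 0 ->
  (fun k => Num.sqrt (y k i) - Num.sqrt (x k i)) @ \oo --> 0.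
Proof.
move=> w0 y0 x0 yx0; apply/norm_cvg0P.
set d := fun k => Num.sqrt (y k i) - Num.sqrt (x k i).
have dd : (fun k => d k ^+ 2) @ \oo --> 0.
  apply: (@squeeze_cvgr _ _ _ _
    (fun=> 0) (fun k => (w i)^-1 * wkl w (y k) (x k))).
  - by apply: nearW => k; rewrite sqr_ge0 wkl_ge_sqrt.
  - exact: cvg_cst.
  - by rewrite -(mulr0 (w i)^-1); apply: cvgM yx0; exact: cvg_cst.
rewrite (_ : (fun _ => _) = fun k => Num.sqrt (d k ^+ 2)).
  rewrite -(@sqrtr0 R); apply: (continuous_cvg _ _ dd).
  exact: sqrt_continuous.
by apply/funext => k; rewrite sqrtr_sqr.
Qed.

Lemma sqrt_cvg (R : realType) (s : nat -> R) (u : R) :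
  (forall k, 0 <= s k) -> (fun k => Num.sqrt (s k)) @ \oo --> u ->
  s @ \oo --> u ^+ 2.
Proof.
move=> s0 su; rewrite (_ : s = fun k => Num.sqrt (s k) * Num.sqrt (s k)).
  by rewrite expr2; exact: cvgM.
by apply/funext => k; rewrite -expr2 sqr_sqrtr.
Qed.

(** The logarithm of the ratio [x' i / x i] is linear in [r i], so the decrease
of the divergence from [y] depends on [y] through <r, y> only. *)
Lemma wkl_step_sub (R : realType) (I : finType) (w r x x' y : I -> R) (c : R) :
  (forall i, 0 < w i) -> (forall i, 0 < x i) -> (forall i, 0 <= y i) -> 0 < c ->
  (forall i, x' i = c `^ (r i / w i) * x i) ->
  wkl w y x - wkl w y x' =
    ln c * (\sum_i r i * y i) + \sum_i w i * (x i - x' i).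
Proof.
move=> w0 x0 y0 c0 x'E; rewrite /wkl -sumrB mulr_sumr -big_split/=.
apply: eq_bigr => i _.
have p0 : 0 < c `^ (r i / w i) by rewrite powR_gt0.
rewrite -mulrBr kl_sub//; last by rewrite x'E mulr_gt0.
rewrite {1}x'E mulfK ?gt_eqF// ln_powR.
by field; rewrite gt_eqF.
Qed.

Lemma kl_step_gt0 (R : realType) (I : finType) (w r : I -> R) beta x x' :
  kl_step w r beta x x' -> (forall i, 0 < x i) -> forall i, 0 < x' i.
Proof. by move=> [c [c0 x'E _]] x0 i; rewrite x'E mulr_gt0// powR_gt0. Qed.

(** By [wkl_step_sub], [wkl w y x - wkl w y x'] takes the same value at every
point [y] of the hyperplane; the value at [y = x'] is [wkl w x' x]. *)
Lemma kl_step_pythagoras (R : realType) (I : finType) (w r : I -> R)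
    (beta : R) (x x' y : I -> R) :
  (forall i, 0 < w i) -> (forall i, 0 < x i) -> (forall i, 0 <= y i) ->
  kl_step w r beta x x' -> \sum_i r i * y i = beta ->
  wkl w y x = wkl w y x' + wkl w x' x.
Proof.
move=> w0 x0 y0 st yb; have x'0 := kl_step_gt0 st x0.
have [c [c0 x'E x'b]] := st.
have x'0_ i : 0 <= x' i by exact: ltW.
have := wkl_step_sub w0 x0 y0 c0 x'E.
have := wkl_step_sub w0 x0 x'0_ c0 x'E.
by rewrite yb x'b wklxx// subr0 => <- /eqP; rewrite subr_eq addrC => /eqP.
Qed.

(** * Convergence of cyclic projections *)

Lemma bounded_family_subseq (R : realType) (I : finType) (x : nat -> I -> R) :
  (forall i, bounded_fun (x ^~ i)) ->
  exists2 f : nat -> nat, f @ \oo --> \oo & forall i, cvgn (fun k => x (f k) i).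
Proof.
move=> bx.
suff [f f_oo fc] : exists2 f : nat -> nat, f @ \oo --> \oo &
    forall i, i \in enum I -> cvgn (fun k => x (f k) i).
  by exists f => // i; apply: fc; rewrite mem_enum.
elim: (enum I) => [|i s [f f_oo fc]]; first by exists id.
have [|g gi gc] := @bolzano_weierstrass R (fun k => x (f k) i).
  have [M [Mr HM]] := bx i; exists M; split => // B MB k _; exact: HM.
have g_ge k : (k <= g k)%N.
  elim: k => [//|k IHk]; apply: leq_ltn_trans IHk _.
  by move/increasing_seqP : gi; exact.
have g_oo : g @ \oo --> \oo.
  move=> P [M _ MP]; exists M => // k /= Mk.
  by apply: MP => /=; exact: leq_trans (g_ge k).
exists (f \o g); first exact: cvg_comp g_oo f_oo.
move=> j; rewrite inE => /predU1P[->//|/fc/cvg_ex[l xl]].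
by apply/cvg_ex; exists l; apply: cvg_comp g_oo xl.
Qed.

Definition nonneg_solution (R : realType) (I : finType) (N : nat)
    (r : 'I_N -> I -> R) (beta : 'I_N -> R) (y : I -> R) : Prop :=
  (forall i, 0 <= y i) /\ (forall l, \sum_i r l i * y i = beta l).

(** For feasible [y] the divergence [wkl w y (x k)] decreases to a limit, by
amounts [wkl w (x k.+1) (x k)] that therefore tend to 0; so the iterates stay
bounded and successive ones approach each other.  A subsequential limit [p]
taken along multiples of [N] is then the limit of every shifted subsequence,
so it inherits each of the [N] constraints in turn.  Since [p] is itself
feasible, [wkl w p (x k)] is monotone; it tends to 0 along the subsequence,
hence along the whole sequence, and [x k] converges to [p].  The decrease
being the same for all feasible points, the difference of the divergences
from [y] and from [p] does not vary with [k], and it is nonnegative in the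
limit. *)
Theorem kl_cyclic_projections (R : realType) (I : finType) (N : nat)
    (w : I -> R) (r : 'I_N -> I -> R) (beta : 'I_N -> R) (x : nat -> I -> R) :
  (0 < N)%N -> (forall i, 0 < w i) -> (forall i, 0 < x 0%N i) ->
  (forall k (l : 'I_N), l = (k %% N)%N :> nat ->
    kl_step w (r l) (beta l) (x k) (x k.+1)) ->
  (exists y : I -> R, nonneg_solution r beta y) ->
  exists p : I -> R,
    [/\ nonneg_solution r beta p,
        forall i, (fun k => x k i) @ \oo --> p i
      & forall y : I -> R, nonneg_solution r beta y ->
          wkl w p (x 0%N) <= wkl w y (x 0%N)].
Proof.
move=> N0 w0 x00 xstep [y yf].
have step k := xstep k (Ordinal (ltn_pmod k N0)) erefl.
have x0 k i : 0 < x k i.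
  by elim: k i => [//|k IHk]; exact: kl_step_gt0 (step k) IHk.
have x0_ k i : 0 <= x k i by exact: ltW.
have pyth z : nonneg_solution r beta z ->
    forall k, wkl w z (x k) = wkl w z (x k.+1) + wkl w (x k.+1) (x k).
  by move=> [z0 zb] k; exact: kl_step_pythagoras (step k) (zb _).
have wkl_ni z : nonneg_solution r beta z ->
    nonincreasing_seq (fun k => wkl w z (x k)).
  move=> zf; apply/nonincreasing_seqP => k.
  by rewrite (pyth _ zf k) lerDl wkl_ge0.
have wkl_c z : nonneg_solution r beta z ->
    cvgn (fun k => wkl w z (x k)).
  move=> zf; apply: nonincreasing_is_cvgn; first exact: wkl_ni.
  by exists 0 => _ [k _ <-]; apply: wkl_ge0 => //; exact: zf.1.
have dx i : (fun k => Num.sqrt (x k.+1 i) - Num.sqrt (x k i)) @ \oo --> 0.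
  apply: (@wkl_cvg0_sqrt _ _ w (fun k => x k.+1) x) => //.
  have /cvg_ex[L yL] := wkl_c _ yf.
  rewrite (_ : (fun _ => _) = fun k => wkl w y (x k) - wkl w y (x k.+1)).
    rewrite -(subrr L); apply: cvgB => //.
    by rewrite -cvg_shiftS in yL.
  by apply/funext => k; rewrite (pyth _ yf k) addrAC subrr add0r.
(* The triangle inequality, from the bound on the distance to the feasible
   point y. *)
have bnd i : bounded_fun (fun k => Num.sqrt (x k i)).
  pose M := Num.sqrt (y i) + Num.sqrt ((w i)^-1 * wkl w y (x 0%N)).
  exists M; split; first exact: num_real.
  move=> B MB k _; apply: le_trans (ltW MB).
  rewrite ger0_norm ?sqrtr_ge0// -lerBlDl.
  apply: le_trans (ler_norm _) _; rewrite distrC -sqrtr_sqr ler_wsqrtr//.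
  apply: le_trans (wkl_ge_sqrt _ w0 yf.1 (x0 k)) _.
  apply: ler_wpM2l; first by rewrite invr_ge0 ltW.
  exact: (wkl_ni _ yf 0%N k).
have [|f f_oo fc] :=
  @bounded_family_subseq _ _ (fun k i => Num.sqrt (x (N * k)%N i)).
  move=> i; have [M [Mr HM]] := bnd i; exists M; split => // B MB k _.
  exact: HM.
have g_oo : (fun k => N * f k)%N @ \oo --> \oo.
  exact: cvg_comp f_oo (cvg_mulnl N N0).
pose u i := limn (fun k => Num.sqrt (x (N * f k)%N i)).
pose p i := u i ^+ 2.
have p0 i : 0 <= p i by exact: sqr_ge0.
(* Successive differences of the square roots tend to 0, so a fixed shift of
   the subsequence does not change its limit. *)
have xgs s i : (fun k => x (N * f k + s)%N i) @ \oo --> p i.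
  apply: sqrt_cvg => //; elim: s => [|s IHs].
    by under eq_fun do rewrite addn0; exact: fc.
  rewrite (_ : (fun _ => _) = fun k => Num.sqrt (x (N * f k + s)%N i) +
    (Num.sqrt (x (N * f k + s).+1 i) - Num.sqrt (x (N * f k + s)%N i))).
    rewrite -(addr0 (u i)); apply: cvgD => //.
    apply: (cvg_comp (fun k => N * f k + s)%N _ _ (dx i)).
    exact: cvg_comp g_oo (cvg_addnr s).
  by apply/funext => k; rewrite addnS addrC subrK.
(* Time N * f k + l treats constraint l, so the next iterate satisfies it. *)
have pb l : \sum_i r l i * p i = beta l.
  have h : (fun k => \sum_i r l i * x (N * f k + l).+1 i) @ \oo -->
      \sum_i r l i * p i.
    apply: (cvg_big add_continuous) => i _; apply: cvgM; first exact: cvg_cst.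
    by under eq_fun do rewrite -addnS; exact: xgs.
  rewrite -(cvg_lim (@Rhausdorff R) h) (_ : (fun _ => _) = fun=> beta l).
    exact: lim_cst.
  apply/funext => k.
  have [|c [_ _ ->//]] := xstep (N * f k + l)%N l.
  by rewrite mulnC modnMDl modn_small.
have pf : nonneg_solution r beta p by split.
have px0 : (fun k => wkl w p (x k)) @ \oo --> 0.
  have /cvg_ex[L pL] := wkl_c _ pf.
  have pgL : (fun k => wkl w p (x (N * f k)%N)) @ \oo --> L.
    exact: (cvg_comp (fun k => N * f k)%N _ g_oo pL).
  suff pg0 : (fun k => wkl w p (x (N * f k)%N)) @ \oo --> 0.
    by rewrite (cvg_unique (@Rhausdorff R) pg0 pgL).
  rewrite (_ : 0 = \sum_(i : I) w i * 0); last first.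
    by rewrite big1// => i _; rewrite mulr0.
  apply: (cvg_big add_continuous) => i _; apply: cvgM; first exact: cvg_cst.
  apply: kl_cvg0 => //.
  by have := xgs 0%N i; under eq_fun do rewrite addn0.
exists p; split => //.
- move=> i.
  have d0 := @wkl_cvg0_sqrt _ _ w (fun=> p) x i w0 (fun=> p0) x0 px0.
  rewrite -(sqr_sqrtr (p0 i)); apply: sqrt_cvg => //.
  rewrite (_ : (fun _ => _) = fun k =>
    Num.sqrt (p i) - (Num.sqrt (p i) - Num.sqrt (x k i))).
    by rewrite -[X in _ --> X]subr0; apply: cvgB => //; exact: cvg_cst.
  by apply/funext => k; rewrite opprB addrC subrK.
- move=> z zf.
  have gap k : wkl w z (x 0%N) - wkl w p (x 0%N) =
      wkl w z (x k) - wkl w p (x k).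
    elim: k => [//|k ->]; rewrite (pyth _ zf k) (pyth _ pf k); ring.
  rewrite -subr_le0; apply: (cvgr_to_ge px0); apply: nearW => k.
  by rewrite -opprB (gap k) opprB lerBlDl lerDr wkl_ge0//; exact: zf.1.
Qed.

Lemma cvg_mx_entries (R : realType) (m n : nat) (M : nat -> 'M[R]_(m, n))
    (L : 'M[R]_(m, n)) :
  (forall i j, (fun k => M k i j) @ \oo --> L i j) -> M @ \oo --> L.
Proof.
move=> ML; apply/cvg_mx_entourageP => A entA.
apply: filter_forall => i; apply: filter_forall => j.
have := ML i j => /cvg_app_entourageP/(_ A entA).
by apply: filterS => k Ak; first exact: mem_set.
Qed.

(** * The transport problem as a single divergence *)

(** The pair of a plan and a vector of penalised values as one point, with the
plan restricted to [Z]: the entries outside [Z] vanish and would not be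
admissible as reference values of the divergence. *)
Definition coord (R : realType) (m n N1 : nat) (Z : {set 'I_m * 'I_n})
    (T : 'M[R]_(m, n)) (b : 'I_N1 -> R) (s : {p in Z} + 'I_N1) : R :=
  match s with inl p => T (val p).1 (val p).2 | inr l => b l end.

Definition weight (R : realType) (m n N1 : nat) (Z : {set 'I_m * 'I_n})
    (gamma : 'I_N1 -> R) : {p in Z} + 'I_N1 -> R :=
  coord (const_mx 1) gamma.
Arguments weight {R m n N1} Z gamma _.

(** The l-th linear form in the variables (T, b): lin T - b l for a penalised
constraint, lin T for an equality constraint.  The coefficient -1 of b l makes
the factor c ^ (-1 / gamma l) of the algorithm an instance of
[c `^ (r i / w i)]. *)
Definition constraint_row (R : realType) (m n N N1 : nat)
    (Z : {set 'I_m * 'I_n}) (a : 'I_N -> 'M[R]_(m, n)) (l : 'I_N) :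
    {p in Z} + 'I_N1 -> R :=
  coord (a l) (fun s => - (s == l :> nat)%:R).
Arguments constraint_row {R m n N N1} Z a l _.

Definition constraint_rhs (R : realType) (N N1 : nat) (btilde : 'I_N -> R)
    (l : 'I_N) : R :=
  if (l < N1)%N then 0 else btilde l.

Lemma constraint_row_sum (R : realType) (m n N N1 : nat)
    (Z : {set 'I_m * 'I_n}) (a : 'I_N -> 'M[R]_(m, n)) (T : 'M[R]_(m, n))
    (b : 'I_N1 -> R) (l : 'I_N) :
  \sum_i constraint_row Z a l i * coord T b i =
    lin Z (a l) T - \sum_(s < N1 | s == l :> nat) b s.
Proof.
rewrite big_sumType/= -sumrN /lin [in RHS]big_sub; congr (_ + _).
rewrite [RHS]big_mkcond/=; apply: eq_bigr => s _ /=.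
by case: eqP => _; rewrite ?mulN1r// oppr0 mul0r.
Qed.

Lemma constraint_row_penalty (R : realType) (m n N N1 : nat)
    (hN1 : (N1 <= N)%N) (Z : {set 'I_m * 'I_n}) (a : 'I_N -> 'M[R]_(m, n))
    (T : 'M[R]_(m, n)) (b : 'I_N1 -> R) (l : 'I_N1) :
  \sum_i constraint_row Z a (widen_ord hN1 l) i * coord T b i =
    lin Z (a (widen_ord hN1 l)) T - b l.
Proof.
by rewrite constraint_row_sum (big_pred1 l)// => s; rewrite /= -val_eqE.
Qed.

Lemma constraint_row_equality (R : realType) (m n N N1 : nat)
    (Z : {set 'I_m * 'I_n}) (a : 'I_N -> 'M[R]_(m, n)) (T : 'M[R]_(m, n))
    (b : 'I_N1 -> R) (l : 'I_N) :
  (N1 <= l)%N ->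
  \sum_i constraint_row Z a l i * coord T b i = lin Z (a l) T.
Proof.
move=> l_ge; rewrite constraint_row_sum big_pred0 ?subr0// => s.
by apply/negbTE; rewrite neq_ltn (leq_trans (ltn_ord s) l_ge).
Qed.

Lemma lin_scaling (R : realType) (m n : nat) (Z : {set 'I_m * 'I_n})
    (A T T' : 'M[R]_(m, n)) (c : R) :
  scaling Z A T T' c ->
  lin Z A T' = scaled_lin Z A T c.
Proof.
move=> TT'; apply: eq_bigr => -[i j] ij /=.
by rewrite TT'// mulrCA mulrC.
Qed.

Lemma penalty_kl_step (R : realType) (m n N N1 : nat)
    (hN1 : (N1 <= N)%N) (Z : {set 'I_m * 'I_n}) (a : 'I_N -> 'M[R]_(m, n))
    (btilde : 'I_N -> R) (gamma : 'I_N1 -> R) (l : 'I_N1)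
    (T : 'M[R]_(m, n)) (b : 'rV[R]_N1) (T' : 'M[R]_(m, n)) (b' : 'rV[R]_N1) :
  penalty_step Z (a (widen_ord hN1 l)) gamma l T b T' b' ->
  kl_step (weight Z gamma) (constraint_row Z a (widen_ord hN1 l))
    (constraint_rhs N1 btilde (widen_ord hN1 l))
    (coord T (b ord0)) (coord T' (b' ord0)).
Proof.
move=> [c [c0 eq0 TT' b'l b's]]; exists c; split => //.
- move=> [[[i j] ij]|s] /=.
    by rewrite /weight /constraint_row/= mxE divr1 TT'.
  rewrite /weight /constraint_row/=.
  have -> : (s == l :> nat) = (s == l) by [].
  case: eqVneq => [->|sl]; first by rewrite mulN1r b'l.
  by rewrite b's// oppr0 mul0r powRr0 mul1r.
- rewrite constraint_row_penalty (lin_scaling TT') b'l.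
  by rewrite /constraint_rhs/= ltn_ord mulrC.
Qed.

Lemma equality_kl_step (R : realType) (m n N N1 : nat)
    (Z : {set 'I_m * 'I_n}) (a : 'I_N -> 'M[R]_(m, n)) (btilde : 'I_N -> R)
    (gamma : 'I_N1 -> R) (l : 'I_N)
    (T : 'M[R]_(m, n)) (b : 'rV[R]_N1) (T' : 'M[R]_(m, n)) (b' : 'rV[R]_N1) :
  (N1 <= l)%N -> equality_step Z (a l) (btilde l) T b T' b' ->
  kl_step (weight Z gamma) (constraint_row Z a l) (constraint_rhs N1 btilde l)
    (coord T (b ord0)) (coord T' (b' ord0)).
Proof.
move=> l_ge [c [c0 eqb TT' ->]]; exists c; split => //.
- move=> [[[i j] ij]|s] /=.
    by rewrite /weight /constraint_row/= mxE divr1 TT'.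
  rewrite /weight /constraint_row/= ltn_eqF ?(leq_trans (ltn_ord s) l_ge)//.
  by rewrite oppr0 mul0r powRr0 mul1r.
- rewrite constraint_row_equality// (lin_scaling TT') eqb.
  by rewrite /constraint_rhs ltnNge l_ge.
Qed.

Definition penalised (R : realType) (m n N N1 : nat)
    (hN1 : (N1 <= N)%N) (Z : {set 'I_m * 'I_n}) (a : 'I_N -> 'M[R]_(m, n))
    (T : 'M[R]_(m, n)) (l : 'I_N1) : R :=
  lin Z (a (widen_ord hN1 l)) T.

(** The penalties are divergences of the additional variables from their
reference values, so minimising the objective over feasible plans means
minimising [wkl] over the feasible points of the lifted linear system. *)
Lemma objectiveE (R : realType) (m n N N1 : nat)
    (hN1 : (N1 <= N)%N) (Z : {set 'I_m * 'I_n}) (a : 'I_N -> 'M[R]_(m, n))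
    (btilde : 'I_N -> R) (gamma : 'I_N1 -> R) (K T : 'M[R]_(m, n)) :
  objective hN1 Z K a btilde gamma T =
    wkl (weight Z gamma) (coord T (penalised hN1 Z a T))
      (coord K (fun l => btilde (widen_ord hN1 l))).
Proof.
rewrite /wkl big_sumType/= /objective /KL [in LHS]big_sub; congr (_ + _).
by apply: eq_bigr => p _; rewrite /weight/= mxE mul1r.
Qed.

(** The coefficients of the penalised constraints being nonnegative, the lifted
variables are nonnegative too, as the divergence from the lifted point
requires. *)
Lemma coord_feasible (R : realType) (m n N N1 : nat)
    (hN1 : (N1 <= N)%N) (Z : {set 'I_m * 'I_n}) (a : 'I_N -> 'M[R]_(m, n))
    (btilde : 'I_N -> R) (T : 'M[R]_(m, n)) :
  (forall l : 'I_N, (l < N1)%N -> forall i j, (i, j) \in Z -> 0 <= a l i j) ->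
  feasible N1 Z a btilde T ->
  nonneg_solution (constraint_row Z a) (constraint_rhs N1 btilde)
    (coord T (penalised hN1 Z a T)).
Proof.
move=> a0 [[T0 _] Tb]; split.
  move=> [[[i j] ij]|l] /=; first exact: T0.
  apply: sumr_ge0 => -[i j] ij /=.
  by rewrite mulr_ge0 ?T0// a0//= ltn_ord.
move=> l; rewrite /constraint_rhs; case: ltnP => [l_lt|l_ge].
  have -> : l = widen_ord hN1 (Ordinal l_lt) by apply: val_inj.
  by rewrite constraint_row_penalty subrr.
by rewrite constraint_row_equality// Tb.
Qed.

Unset Implicit Arguments.

Theorem theorem1 (R : realType) (m n : nat) (hm : (1 <= m)%N) (hn : (1 <= n)%N)
    (Z : {set 'I_m * 'I_n})
    (hZrow : forall i : 'I_m, exists j : 'I_n, (i, j) \in Z)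
    (hZcol : forall j : 'I_n, exists i : 'I_m, (i, j) \in Z)
    (cost tref : 'M[R]_(m, n)) (gamma0 : R) (hgamma0 : 0 < gamma0)
    (htref : forall (i : 'I_m) (j : 'I_n), (i, j) \in Z -> 0 < tref i j)
    (N N1 : nat) (hN : (1 <= N)%N) (hN1 : (N1 <= N)%N)
    (a : 'I_N -> 'M[R]_(m, n)) (btilde : 'I_N -> R) (gamma : 'I_N1 -> R)
    (ha : forall l : 'I_N, (l < N1)%N ->
       forall (i : 'I_m) (j : 'I_n), (i, j) \in Z -> 0 <= a l i j)
    (hbtilde : forall l : 'I_N, (l < N1)%N -> 0 < btilde l)
    (hgamma : forall l : 'I_N1, 0 < gamma l)
    (hfeas : exists T : 'M[R]_(m, n), feasible N1 Z a btilde T)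
    (T : nat -> 'M[R]_(m, n)) (b : nat -> 'rV[R]_N1)
    (hgen : generated hN1 Z (Kmx Z cost tref gamma0) a btilde gamma T b) :
  exists (Tstar : 'M[R]_(m, n)) (bstar : 'rV[R]_N1),
    (fun k : nat => (T k, b k)) @ \oo --> (Tstar, bstar) /\
    is_minimizer hN1 Z (Kmx Z cost tref gamma0) a btilde gamma Tstar.
Proof.
have [T_all T0 b0 pen eqs] := hgen.
set K := Kmx Z cost tref gamma0 in T0 *.
have x0E : coord (T 0%N) (b 0%N ord0) =
    coord K (fun l => btilde (widen_ord hN1 l)) :> ({p in Z} + 'I_N1 -> R).
  by apply/funext => -[[[i j] ij]|l] /=; [exact: T0 | exact: b0].
have [||||p [[p0 pb] px pmin]] := @kl_cyclic_projections R
  ({p in Z} + 'I_N1)%type N (weight Z gamma) (constraint_row Z a)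
  (constraint_rhs N1 btilde) (fun k => coord (T k) (b k ord0)) hN.
- by move=> [u|l] //=; rewrite /weight/= mxE.
- rewrite x0E => -[[[i j] ij]|l] /=; last by rewrite hbtilde/=.
  by rewrite mxE ij mulr_gt0 ?expR_gt0 ?htref.
- move=> k l lk; have [l_lt|l_ge] := ltnP l N1.
    have lE : l = widen_ord hN1 (Ordinal l_lt) by apply: val_inj.
    by rewrite lE; apply: penalty_kl_step; apply: pen.
  by apply: equality_kl_step => //; apply: eqs.
- have [S S_feas] := hfeas.
  by exists (coord S (penalised hN1 Z a S)); exact: coord_feasible.
pose Ts : 'M[R]_(m, n) :=
  \matrix_(i, j) oapp (fun u : {p in Z} => p (inl u)) 0 (insub (i, j)).
pose bs : 'rV[R]_N1 := \row_l p (inr l).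
have TsE i j (ij : (i, j) \in Z) : Ts i j = p (inl (exist _ (i, j) ij)).
  by rewrite mxE insubT.
have Ts0 i j : (i, j) \notin Z -> Ts i j = 0 by move=> ij; rewrite mxE insubN.
have pE : coord Ts (bs ord0) = p.
  apply/funext => -[[[i j] ij]|l] /=; [exact: TsE | by rewrite mxE].
have Ts_feas : feasible N1 Z a btilde Ts.
  split; first by split => [i j ij|//]; rewrite TsE.
  move=> l l_ge; have := pb l; rewrite -pE constraint_row_equality//.
  by rewrite /constraint_rhs ltnNge l_ge.
have bsE : bs ord0 = penalised hN1 Z a Ts.
  apply/funext => l; apply/eqP; rewrite eq_sym -subr_eq0.
  by rewrite -constraint_row_penalty pE pb /constraint_rhs/= ltn_ord.
exists Ts, bs; split.
  apply: (@cvg_pair _ _ _ _ (nbhs Ts) (nbhs bs)).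
    apply: cvg_mx_entries => i j; case: (boolP ((i, j) \in Z)) => ij.
      by rewrite TsE; exact: px (inl (exist _ (i, j) ij)).
    rewrite Ts0// (_ : (fun _ => _) = fun=> 0); first exact: cvg_cst.
    by apply/funext => k; exact: (T_all k).2.
  by apply: cvg_mx_entries => i j; rewrite ord1 mxE; exact: px (inr j).
split=> // S S_feas; rewrite !objectiveE -/K -x0E -bsE pE.
by apply: pmin; exact: coord_feasible.
Qed.
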